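(* Let $X$ and $Y$ be compact Hausdorff spaces, let $A$ and $B$ be sublattices of $C(X,I)$ and $C(Y,I)$, respectively, both having Urysohn's property, and let $\varphi:A\longrightarrow B$ be a lattice isomorphism. Then $\varphi$ induces a homeomorphism $\mu$ from $Y$ onto $X$; that is, for each $y\in Y$ there is exactly one point $x\in X$ such that $\varphi^{-1}(g)(x)=0$ for every $g\in B$ vanishing on a neighborhood of $y$, and the map $\mu:Y\longrightarrow X$ sending $y$ to this point $x$ is a homeomorphism. If, furthermore, (i) $A$ and $B$ are closed under (pointwise) multiplication, and (ii) the evaluation of $A$ on $X$ and the evaluation of $B$ on $Y$ are dense in $I$, then there exist a dense $G_\delta$ subset $Y_0$ of $Y$ and a family $\{m_y\}_{y\in Y_0}$ of strictly increasing continuous bijections $m_y:I\longrightarrow I$ such that \[\varphi(f)(y)=m_y\big(f(\mu(y))\big)\qquad (f\in A,\ y\in Y_0).\]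
   Context: $I=[0,1]$. For a compact Hausdorff space $X$, $C(X,I)$ is the lattice of all continuous functions $X\to I$, with $f\vee g=\max(f,g)$ and $f\wedge g=\min(f,g)$ pointwise; a sublattice is a subset closed under $\vee$ and $\wedge$ (it need not contain all constants). A lattice isomorphism $\varphi:A\to B$ is a bijection with $\varphi(f\wedge g)=\varphi(f)\wedge\varphi(g)$ and $\varphi(f\vee g)=\varphi(f)\vee\varphi(g)$ for all $f,g\in A$. A subset $A\subseteq C(X,I)$ has Urysohn's property if for any pair of disjoint closed subsets $F,G$ of $X$ (the empty set is allowed) there exists $f\in A$ with $f=0$ on $F$ and $f=1$ on $G$. The evaluation of $A$ on $X$ is dense in $I$ if for each $x\in X$ the set $A_x=\{f(x):f\in A\}$ is dense in $I$. *)

(* Defs.v *)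
From HB Require Import structures.
From mathcomp Require Import all_boot all_order all_algebra.
From mathcomp Require Import all_classical all_reals all_analysis.

Set Implicit Arguments.
Unset Strict Implicit.
Unset Printing Implicit Defensive.

Import Order.TTheory GRing.Theory Num.Theory.
Import numFieldNormedType.Exports.

Local Open Scope classical_set_scope.
Local Open Scope ring_scope.

(* C(X, I) for I = [0, 1], as real-valued functions with range in I. *)
Definition CI (R : realType) (X : topologicalType) : set (X -> R) :=
  [set f : X -> R | continuous f /\ forall x, f x \in `[0, 1]].

Definition sublattice_CI (R : realType) (X : topologicalType)
    (A : set (X -> R)) : Prop :=
  [/\ A `<=` @CI R X,
      (forall f g, A f -> A g -> A (f \min g)) &
      (forall f g, A f -> A g -> A (f \max g))].

Definition urysohn_property (R : realType) (X : topologicalType)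
    (A : set (X -> R)) : Prop :=
  forall F G : set X, closed F -> closed G -> F `&` G = set0 ->
    exists f, [/\ A f, (forall x, F x -> f x = 0) & (forall x, G x -> f x = 1)].

(* Only the values of [phi] on [A] matter. *)
Definition lattice_isomorphism (R : realType) (X Y : topologicalType)
    (A : set (X -> R)) (B : set (Y -> R)) (phi : (X -> R) -> (Y -> R)) : Prop :=
  [/\ set_bij A B phi,
      (forall f g, A f -> A g -> phi (f \min g) = (phi f \min phi g)) &
      (forall f g, A f -> A g -> phi (f \max g) = (phi f \max phi g))].

(* [pinv A phi g] is the unique element of [A] sent to [g] when [phi] is a
   bijection from [A] onto [B] and [g] belongs to [B]. *)
Definition corresponds (R : realType) (X Y : topologicalType)
    (A : set (X -> R)) (B : set (Y -> R)) (phi : (X -> R) -> (Y -> R))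
    (y : Y) (x : X) : Prop :=
  forall g, B g -> (\forall z \near y, g z = 0) -> pinv A phi g x = 0.

Definition homeomorphism (S T : topologicalType) (h : S -> T) : Prop :=
  continuous h /\
  exists k : T -> S, [/\ cancel h k, cancel k h & continuous k].

Definition mul_closed (R : realType) (X : Type) (A : set (X -> R)) : Prop :=
  forall f g, A f -> A g -> A (f \* g).

(* For [A] included in [CI] the values f x lie in [0, 1], so density in the
   subspace [0, 1] means that the closure taken in R contains [0, 1]. *)
Definition dense_evaluation (R : realType) (X : topologicalType)
    (A : set (X -> R)) : Prop :=
  forall x : X, [set` `[0, 1]] `<=` closure [set f x | f in A].

Definition increasing_bijection_I (R : realType) (m : R -> R) : Prop :=
  [/\ set_bij [set` `[0, 1]] [set` `[0, 1]] m,
      {within `[0, 1], continuous m} &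
      {in `[0, 1]%R &, forall s t, s < t -> m s < m t}].

(* Main.v *)
Require Import Defs.
From mathcomp Require Import all_boot all_order all_algebra.
From mathcomp Require Import all_classical all_reals all_analysis borel_hierarchy.
Import numFieldNormedType.Exports.
Import Order.TTheory GRing.Theory Num.Theory.
Local Open Scope classical_set_scope.
Local Open Scope ring_scope.

Set Implicit Arguments.
Unset Strict Implicit.
Unset Printing Implicit Defensive.

(** A lattice isomorphism fixes the constants 0 and 1, hence preserves two
    pointwise relations between functions: f /\ g = 0 (everywhere one of the two
    vanishes) and f \/ g = 1 (everywhere one of the two equals 1).  These suffice
    to transport germs.  Say that x carries y when phi f vanishes at y as soon
    as f vanishes near x.  Compactness of X provides, for each y, a common zero x
    of all the functions psi g with g = 0 near y, where psi is the inverse of phi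
    ([exists_carried]); disjointness turns this into x carries y
    ([carries_zero_germs_sym]), so that the relation is symmetric in the two
    lattices.  The relation f \/ g = 1 yields the tool from which all the rest
    follows ([carried_bump]): if x carries y, every neighbourhood of x supports
    some h in A with phi h y = 1.  Uniqueness and continuity of y |-> mu y are
    immediate, the same map for psi is the continuous inverse, and cutting off
    by h shows that f <= g near mu y implies phi f y <= phi g y
    ([phi_local_monotone]).

    For the representation, the last fact says that f (mu y) < g (mu y) implies
    phi f y <= phi g y, so phi f y is nearly a function of f (mu y): only
    jumps have to be excluded.  A jump of phi at y over an interval ]a, b[ is
    excluded when some f, g in A satisfy f (mu y) < g (mu y) while
    a < phi f y and phi g y < b.  Such y form an open set, which is dense
    because two functions of B that are strictly ordered at a point cannot have
    preimages in A ordered the other way near the corresponding point.  By the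
    Baire property of compact Hausdorff spaces, the points y satisfying this for
    all rational a < b in [0, 1], together with the symmetric condition for psi, form a
    dense G_delta set.  At such y the pairs (f (mu y), phi f y) are the graph of
    a strictly increasing map between dense subsets of [0, 1] containing 0 and
    1, and this map extends to an increasing bijection of [0, 1]
    ([monotone_graph_extension]). *)

(** * Compact Hausdorff spaces *)

Lemma compact_closed_nbhs (T : topologicalType) (x : T) (U : set T) :
  compact [set: T] -> hausdorff_space T -> nbhs x U ->
  exists K, [/\ closed K, nbhs x K & K `<=` U^°].
Proof.
move=> cT hT /nbhs_interior xU.
have [V xV VU] := @compact_regular T x setT hT cT filterT _ xU.
exists (closure V); split => //; first exact: closed_closure.
by apply: filterS xV; exact: subset_closure.
Qed.

(** Nested nonempty open sets W n, the closure of each successor lying in W n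
    and in F n, have closures with a common point by compactness. *)
Lemma compact_baire (T : topologicalType) (F : nat -> set T) :
  compact [set: T] -> hausdorff_space T ->
  (forall i, open (F i)) -> (forall i, dense (F i)) -> dense (\bigcap_i F i).
Proof.
move=> cT hT oF dF O O0 oO.
(* The premises are put after the existential so that a choice function on all
   pairs can be extracted. *)
have step (p : nat * set T) : exists V, open p.2 -> p.2 !=set0 ->
    [/\ open V, V !=set0 & closure V `<=` p.2 `&` F p.1].
  case: p => n U /=.
  have [[oU U0]|nU] := pselect (open U /\ U !=set0); last first.
    by exists set0 => oU U0; case: nU.
  have [x [Ux Fx]] := dF n _ U0 oU.
  have xUF : nbhs x (U `&` F n).
    by apply: open_nbhs_nbhs; split; [exact: openI|split].
  have [K [cK xK KUF]] := compact_closed_nbhs cT hT xUF.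
  exists K^° => _ _; split; [exact: open_interior| |].
  - by exists x; exact: nbhs_singleton (nbhs_interior xK).
  - apply: subset_trans _ (subset_trans KUF (@interior_subset _ _)).
    rewrite {2}(closure_id K).1//.
    by apply: closure_subset; exact: interior_subset.
have [s sP] := choice step.
pose W := fix W n := if n is n'.+1 then s (n', W n') else O.
have WP n : open (W n) /\ W n !=set0.
  by elim: n => [//|n [oW W0]]; have [] := sP (n, W n) oW W0.
have WS n : closure (W n.+1) `<=` W n `&` F n.
  by have [oW W0] := WP n; have [] := sP (n, W n) oW W0.
have Wmono m n : (m <= n)%N -> W n `<=` W m.
  move=> /subnK <-; elim: (n - m)%N => [//|k IH]; apply: subset_trans _ IH.
  by move=> z /subset_closure /WS [].
have FF : Filter (filter_from [set: nat] W).
  apply: filter_from_filter; first by exists 0%N.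
  move=> i j _ _; exists (maxn i j) => //.
  by move=> z Wz; split; apply: Wmono Wz; rewrite ?leq_maxl ?leq_maxr.
have PF : ProperFilter (filter_from [set: nat] W).
  by apply: filter_from_proper => i _; have [] := WP i.
have [p [_ clp]] := cT _ PF filterT.
have pW n : closure (W n) p by move=> B pB; apply: clp => //; exists n.
exists p; split=> [|n _]; first by have [] := WS _ _ (pW 1%N).
by have [] := WS _ _ (pW n.+1).
Qed.

(** * Extending monotone graphs *)

(** The extension is m u = sup of all t related to some s <= u.  Density of the
    first projection makes m strictly increasing, density of the second makes it
    onto, and an increasing surjection between segments is continuous. *)
Lemma monotone_graph_extension (R : realType) (S : R -> R -> Prop) :
  (forall s t, S s t -> (s \in `[0, 1]) && (t \in `[0, 1])) ->
  S 0 0 -> S 1 1 ->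
  (forall s t s' t', S s t -> S s' t' -> (s < s') = (t < t')) ->
  (forall a b, 0 <= a -> a < b -> b <= 1 ->
     exists s t, S s t /\ a < s < b) ->
  (forall a b, 0 <= a -> a < b -> b <= 1 ->
     exists s t, S s t /\ a < t < b) ->
  exists m, increasing_bijection_I m /\ forall s t, S s t -> m s = t.
Proof.
move=> S01 S0 S1 Smono Sl Sr.
have Sle s t s' t' : S s t -> S s' t' -> (s <= s') = (t <= t').
  by move=> h h'; rewrite !leNgt (Smono _ _ _ _ h' h).
have St0 s t : S s t -> 0 <= t by move=> /S01 /andP[_]; rewrite in_itv => /andP[].
have St1 s t : S s t -> t <= 1 by move=> /S01 /andP[_]; rewrite in_itv => /andP[].
have Ss0 s t : S s t -> 0 <= s by move=> /S01 /andP[+ _]; rewrite in_itv => /andP[].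
have Ss1 s t : S s t -> s <= 1 by move=> /S01 /andP[+ _]; rewrite in_itv => /andP[].
pose E u := [set t | exists s, S s t /\ s <= u].
pose m u := sup (E u).
have Eub u : has_ubound (E u) by exists 1 => t [s [/St1]].
have E0 u : 0 <= u -> E u !=set0 by move=> u0; exists 0, 0.
have mge u s t : S s t -> s <= u -> t <= m u.
  by move=> Sst su; apply: ub_le_sup => //; exists s.
have mle u s t : 0 <= u -> S s t -> u <= s -> m u <= t.
  move=> u0 Sst us; apply: ge_sup; first exact: E0.
  by move=> t' [s' [S' s'u]]; rewrite -(Sle _ _ _ _ S' Sst) (le_trans s'u).
have mS s t : S s t -> m s = t.
  move=> Sst; apply/eqP; rewrite eq_le (mge _ _ _ Sst) // (mle _ _ _ _ Sst) //.
  exact: Ss0 Sst.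
have m01 u : u \in `[0, 1] -> m u \in `[0, 1].
  rewrite !in_itv /= => /andP[u0 u1].
  by rewrite (mge _ _ _ S0) // (mle _ _ _ _ S1).
have minc : {in `[0, 1]%R &, forall s t, s < t -> m s < m t}.
  move=> u v; rewrite !in_itv /= => /andP[u0 u1] /andP[v0 v1] uv.
  have [s [t [Sst /andP[us sv]]]] := Sl u v u0 uv v1.
  have [s' [t' [Sst' /andP[ss' sv']]]] := Sl s v (Ss0 _ _ Sst) sv v1.
  apply: (le_lt_trans (mle _ _ _ u0 Sst (ltW us))).
  apply: lt_le_trans (mge _ _ _ Sst' (ltW sv')).
  by rewrite -(Smono _ _ _ _ Sst Sst').
have msurj v : v \in `[0, 1] -> exists2 u, u \in `[0, 1] & m u = v.
  rewrite in_itv /= => /andP[v0 v1].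
  pose D := [set s | exists t, S s t /\ t <= v].
  have Dub : has_ubound D by exists 1 => s [t [/Ss1]].
  have D0 : D 0 by exists 0.
  have u0 : 0 <= sup D by exact: ub_le_sup.
  have u1 : sup D <= 1 by apply: ge_sup; [exists 0|move=> s [t [/Ss1]]].
  exists (sup D); first by rewrite in_itv /= u0.
  have mu01 : m (sup D) \in `[0, 1] by apply: m01; rewrite in_itv /= u0.
  move: mu01; rewrite in_itv /= => /andP[mu0 mu1].
  have [lt|lt|//] := ltgtP (m (sup D)) v.
  - have [s [t [Sst /andP[mt tv]]]] := Sr _ _ mu0 lt v1.
    have : t <= m (sup D).
      apply: (mge _ _ _ Sst); apply: ub_le_sup => //.
      by exists t; rewrite (ltW tv).
    by rewrite leNgt mt.
  - have [s [t [Sst /andP[vt tm]]]] := Sr _ _ v0 lt mu1.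
    have : m (sup D) <= t.
      apply: (mle _ _ _ _ Sst) => //; apply: ge_sup; first by exists 0.
      move=> s' [t' [Sst' t'v]]; rewrite (Sle _ _ _ _ Sst' Sst).
      exact: le_trans t'v (ltW vt).
    by rewrite leNgt tm.
exists m; split => //.
have mmono : {in `[0, 1]%R &, {mono m : x y / x <= y}} by exact: le_mono_in.
split => //.
- split.
  + by move=> u /= /m01.
  + by move=> u v; rewrite !inE; exact: (inc_inj_in mmono).
  + by move=> v /= /msurj [u u01 <-]; exists u.
- apply: segment_inc_surj_continuous => //.
  rewrite (mS _ _ S0) (mS _ _ S1) => v /= /msurj [u u01 <-].
  by exists u.
Qed.

(** * Isomorphic lattices of functions *)

(** All the data of the theorem, with the inverse of phi named.  The bundle is
    invariant under exchanging (X, A, phi) and (Y, B, psi), which makes every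
    lemma about phi available for psi. *)
Record lattice_duality (R : realType) (X Y : topologicalType)
    (A : set (X -> R)) (B : set (Y -> R))
    (phi : (X -> R) -> (Y -> R)) (psi : (Y -> R) -> (X -> R)) : Prop := {
  dual_cptX : compact [set: X];
  dual_hdfX : hausdorff_space X;
  dual_cptY : compact [set: Y];
  dual_hdfY : hausdorff_space Y;
  dual_latA : sublattice_CI A;
  dual_latB : sublattice_CI B;
  dual_uryA : urysohn_property A;
  dual_uryB : urysohn_property B;
  dual_isoA : lattice_isomorphism A B phi;
  dual_isoB : lattice_isomorphism B A psi;
  dual_phiK : forall f, A f -> psi (phi f) = f;
  dual_psiK : forall g, B g -> phi (psi g) = g }.

Lemma dual_sym (R : realType) (X Y : topologicalType)
    (A : set (X -> R)) (B : set (Y -> R)) phi psi :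
  lattice_duality A B phi psi -> lattice_duality B A psi phi.
Proof. by case. Qed.

Lemma duality_of_iso (R : realType) (X Y : topologicalType)
    (A : set (X -> R)) (B : set (Y -> R)) phi :
  compact [set: X] -> hausdorff_space X ->
  compact [set: Y] -> hausdorff_space Y ->
  sublattice_CI A -> sublattice_CI B ->
  urysohn_property A -> urysohn_property B ->
  lattice_isomorphism A B phi -> lattice_duality A B phi (pinv A phi).
Proof.
move=> cX hX cY hY latA latB uA uB iso.
have [bij phimin phimax] := iso.
have [_ Amin Amax] := latA.
have [AB inj surj] := bij.
have phiK f : A f -> pinv A phi (phi f) = f.
  by move=> Af; apply: pinvKV; rewrite ?inE.
have psiK g : B g -> phi (pinv A phi g) = g.
  by move=> Bg; exact: (surjpK _ surj (mem_set Bg)).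
have bijV := bijpinv_bij (fun=> point) bij.
have [BA _ _] := bijV.
split => //; split => //.
- move=> g h Bg Bh; have Ag := BA _ Bg; have Ah := BA _ Bh.
  by rewrite -{1}(psiK _ Bg) -{1}(psiK _ Bh) -phimin// phiK//; exact: Amin.
- move=> g h Bg Bh; have Ag := BA _ Bg; have Ah := BA _ Bh.
  by rewrite -{1}(psiK _ Bg) -{1}(psiK _ Bh) -phimax// phiK//; exact: Amax.
Qed.

(** This is the relation [corresponds] for the inverse isomorphism, with the
    inverse made explicit. *)
Definition carries_zero_germs (R : realType) (X Y : topologicalType)
    (A : set (X -> R)) (phi : (X -> R) -> (Y -> R)) (x : X) (y : Y) : Prop :=
  forall f, A f -> (\forall z \near x, f z = 0) -> phi f y = 0.

Lemma near_lt_fun (R : realType) (X : topologicalType) (f g : X -> R) (x : X) :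
  continuous f -> continuous g ->
  f x < g x -> \forall z \near x, f z < g z.
Proof.
move=> cf cg fg; have fg0 : f x - g x < 0 by rewrite subr_lt0.
have lt0 : \forall z \near x, (f - g) z < 0.
  exact: (cvgr_lt _ (cvgB (cf x) (cg x))).
by apply: filterS lt0 => z fgz; rewrite -subr_lt0.
Qed.

Section Duality.
Variables (R : realType) (X Y : topologicalType).
Variables (A : set (X -> R)) (B : set (Y -> R)).
Variables (phi : (X -> R) -> (Y -> R)) (psi : (Y -> R) -> (X -> R)).
Hypothesis dual : lattice_duality A B phi psi.

Lemma sub_continuous f : A f -> continuous f.
Proof. by move: dual => [_ _ _ _ [AC _ _] _ _ _ _ _ _ _] /AC []. Qed.

Lemma sub_itv f x : A f -> 0 <= f x <= 1.
Proof.
move: dual => [_ _ _ _ [AC _ _] _ _ _ _ _ _ _] /AC [_ /(_ x)].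
by rewrite in_itv.
Qed.

Lemma sub_cst0 : A (cst 0).
Proof.
have [f [Af f0 _]] := dual_uryA dual closedT closed0 (setI0 _).
by suff -> : cst 0 = f by []; apply/funext => x; rewrite f0.
Qed.

Lemma sub_cst1 : A (cst 1).
Proof.
have [f [Af _ f1]] := dual_uryA dual closed0 closedT (set0I _).
by suff -> : cst 1 = f by []; apply/funext => x; rewrite f1.
Qed.

Lemma phi_sub f : A f -> B (phi f).
Proof. by have [[AB _ _] _ _] := dual_isoA dual; exact: AB. Qed.

Lemma phi_monotone f g y : A f -> A g -> (forall x, f x <= g x) ->
  phi f y <= phi g y.
Proof.
move=> Af Ag fg; have [_ phimin _] := dual_isoA dual.
have {1}-> : f = f \min g by apply/funext => x; rewrite /= min_l.
by rewrite phimin //= ge_min lexx orbT.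
Qed.

Lemma urysohn_bump (x : X) (U : set X) : nbhs x U ->
  exists f, [/\ A f, (\forall z \near x, f z = 1) & forall z, ~ U z -> f z = 0].
Proof.
move=> xU.
have [K [cK xK KU]] := compact_closed_nbhs (dual_cptX dual) (dual_hdfX dual) xU.
have dis : ~` U^° `&` K = set0.
  by apply/seteqP; split => // z [nU Kz]; exact/nU/KU.
have [f [Af f0 f1]] :=
  dual_uryA dual (open_closedC (@open_interior _ U)) cK dis.
exists f; split => //; first exact: filterS xK.
by move=> z nU; apply: f0 => /interior_subset.
Qed.

End Duality.

Section DualityTheory.
Variables (R : realType) (X Y : topologicalType).
Variables (A : set (X -> R)) (B : set (Y -> R)).
Variables (phi : (X -> R) -> (Y -> R)) (psi : (Y -> R) -> (X -> R)).
Hypothesis dual : lattice_duality A B phi psi.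
Let dualV := dual_sym dual.

Lemma phi_cst0 y : phi (cst 0) y = 0.
Proof.
have B0 := sub_cst0 dualV; have A0 := sub_cst0 dual.
apply/eqP; rewrite eq_le; have /andP[-> _] := sub_itv dualV y (phi_sub dual A0).
rewrite andbT -[leRHS]/(cst 0 y) -(dual_psiK dual B0).
apply: (phi_monotone dual) => //; first exact: (phi_sub dualV B0).
by move=> x; have /andP[] := sub_itv dual x (phi_sub dualV B0).
Qed.

Lemma phi_cst1 y : phi (cst 1) y = 1.
Proof.
have B1 := sub_cst1 dualV; have A1 := sub_cst1 dual.
apply/eqP; rewrite eq_le; have /andP[_ ->] := sub_itv dualV y (phi_sub dual A1).
rewrite -[leLHS]/(cst 1 y) -(dual_psiK dual B1).
apply: (phi_monotone dual) => //; first exact: (phi_sub dualV B1).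
by move=> x; have /andP[] := sub_itv dual x (phi_sub dualV B1).
Qed.

(** Both this lemma and the next one restate the preservation of lattice
    operations pointwise: f /\ g = 0, respectively f \/ g = 1. *)
Lemma phi_disjoint f g : A f -> A g -> (forall x, f x = 0 \/ g x = 0) ->
  forall y, phi f y = 0 \/ phi g y = 0.
Proof.
move=> Af Ag fg y; have [_ phimin _] := dual_isoA dual.
have fg0 : f \min g = cst 0.
  apply/funext => x /=.
  have /andP[f0 _] := sub_itv dual x Af; have /andP[g0 _] := sub_itv dual x Ag.
  by case: (fg x) => ->; [rewrite min_l|rewrite min_r].
have := phimin f g Af Ag; rewrite fg0 => /(congr1 (@^~ y)).
by rewrite phi_cst0 /= minEle; case: ifP => _; [left|right].
Qed.

Lemma phi_covering f g : A f -> A g -> (forall x, f x = 1 \/ g x = 1) ->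
  forall y, phi f y = 1 \/ phi g y = 1.
Proof.
move=> Af Ag fg y; have [_ _ phimax] := dual_isoA dual.
have fg1 : f \max g = cst 1.
  apply/funext => x /=.
  have /andP[_ f1] := sub_itv dual x Af; have /andP[_ g1] := sub_itv dual x Ag.
  by case: (fg x) => ->; [rewrite max_l|rewrite max_r].
have := phimax f g Af Ag; rewrite fg1 => /(congr1 (@^~ y)).
by rewrite phi_cst1 /= maxEle; case: ifP => _; [right|left].
Qed.

End DualityTheory.

Section Germs.
Variables (R : realType) (X Y : topologicalType).
Variables (A : set (X -> R)) (B : set (Y -> R)).
Variables (phi : (X -> R) -> (Y -> R)) (psi : (Y -> R) -> (X -> R)).
Hypothesis dual : lattice_duality A B phi psi.
Let dualV := dual_sym dual.

(** * Carrying germs across the isomorphism *)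

(** The zero sets of the functions psi g, with g = 0 near y, form a filter base
    since psi preserves maxima; a cluster point is the required x.  None of them
    is empty: a bump h at y disjoint from g has psi h disjoint from psi g, so a
    nowhere vanishing psi g would force psi h = 0 and h = 0. *)
Lemma exists_carried y : exists x, carries_zero_germs B psi y x.
Proof.
pose J := [set g | B g /\ \forall z \near y, g z = 0].
pose Z g := [set x | psi g x = 0].
have FZ : Filter (filter_from J Z).
  apply: filter_from_filter.
    by exists (cst 0); split; [exact: (sub_cst0 dualV)|exact: nearW].
  move=> g h [Bg g0] [Bh h0]; exists (g \max h).
    split; first by have [_ _ Bmax] := dual_latB dual; exact: Bmax.
    by apply: filterS2 g0 h0 => z /= -> ->; rewrite maxxx.
  move=> x; rewrite /Z /=; have [_ _ psimax] := dual_isoB dual.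
  rewrite psimax //= => max0.
  have /andP[g1 _] := sub_itv dual x (phi_sub dualV Bg).
  have /andP[h1 _] := sub_itv dual x (phi_sub dualV Bh).
  by split; apply/eqP; rewrite eq_le ?g1 ?h1 -max0 le_max lexx ?orbT.
have PZ : ProperFilter (filter_from J Z).
  apply: filter_from_proper => g [Bg g0].
  have [h [Bh /nbhs_singleton h1 hz]] := urysohn_bump dualV g0.
  apply: contrapT => /forallNP gn0.
  have psih0 : psi h = cst 0.
    apply/funext => x; have hg z : h z = 0 \/ g z = 0.
      by have [/= gz|/hz] := pselect (g z = 0); [right|left].
    by case: (phi_disjoint dualV Bh Bg hg x) => // /gn0.
  have := phi_cst0 dual y; rewrite -psih0 (dual_psiK dual Bh) h1.
  by apply/eqP; rewrite oner_eq0.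
have [x [_ clx]] := dual_cptX dual PZ filterT.
exists x => g Bg g0.
have clZ : closed (Z g).
  apply: (@preimage_closed _ _ (psi g) [set x | x = 0]); last exact: closed_eq.
  by move=> ? _; exact: (sub_continuous dual (phi_sub dualV Bg)).
by apply: clZ => V xV; apply: clx => //; exists g.
Qed.

(** Let h be a bump at x disjoint from f.  If phi f y were nonzero, then phi h
    would vanish near y, and h = psi (phi h) would vanish at x. *)
Lemma carries_zero_germs_sym x y :
  carries_zero_germs B psi y x -> carries_zero_germs A phi x y.
Proof.
move=> yx f Af f0; apply: contrapT => /eqP fy0.
have [h [Ah /nbhs_singleton h1 hz]] := urysohn_bump dual f0.
have Bf := phi_sub dual Af.
have fgt0 : phi (cst 0) y < phi f y.
  by have /andP[f_ge0 _] := sub_itv dualV y Bf; rewrite (phi_cst0 dual) lt_def fy0.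
have : psi (phi h) x = 0.
  apply: yx; first exact: (phi_sub dual Ah).
  have := near_lt_fun (sub_continuous dualV (phi_sub dual (sub_cst0 dual)))
                      (sub_continuous dualV Bf) fgt0.
  apply: filterS => z; rewrite (phi_cst0 dual) => fz.
  have hf w : h w = 0 \/ f w = 0.
    by have [/= fw|/hz] := pselect (f w = 0); [right|left].
  case: (phi_disjoint dual Ah Af hf z) => // fz0.
  by rewrite fz0 ltxx in fz.
by rewrite (dual_phiK dual) // h1; apply/eqP; rewrite oner_eq0.
Qed.

(** Choose k = 0 near x and h supported in U so that h \/ k = 1.  As x carries y,
    phi k y = 0, and phi h \/ phi k = 1 then forces phi h y = 1. *)
Lemma carried_bump x y U : carries_zero_germs A phi x y -> nbhs x U ->
  exists h, [/\ A h, phi h y = 1 & forall z, ~ U z -> h z = 0].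
Proof.
move=> xy xU.
have [K [cK xK KU]] := compact_closed_nbhs (dual_cptX dual) (dual_hdfX dual) xU.
have [L [cL xL LK]] := compact_closed_nbhs (dual_cptX dual) (dual_hdfX dual) xK.
have LK0 : L `&` ~` K^° = set0.
  by apply/seteqP; split => // z [Lz nK]; exact/nK/LK.
have KU0 : ~` U^° `&` K = set0.
  by apply/seteqP; split => // z [nU Kz]; exact/nU/KU.
have [k [Ak k0 k1]] :=
  dual_uryA dual cL (open_closedC (@open_interior _ K)) LK0.
have [h [Ah h0 h1]] :=
  dual_uryA dual (open_closedC (@open_interior _ U)) cK KU0.
exists h; split => //; last by move=> z nU; apply: h0 => /interior_subset.
have ky0 : phi k y = 0 by apply: xy => //; exact: filterS xL.
have [w||//] := phi_covering dual Ak Ah _ y.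
  have [Kw|nKw] := pselect (K w); first by right; exact: h1.
  by left; apply: k1 => /interior_subset.
by rewrite ky0 => /eqP; rewrite eq_sym oner_eq0.
Qed.

(** Disjoint neighbourhoods of x and x' would support disjoint bumps whose
    images both equal 1 at y. *)
Lemma carried_unique x x' y :
  carries_zero_germs A phi x y -> carries_zero_germs A phi x' y -> x = x'.
Proof.
move=> xy x'y; apply: (dual_hdfX dual) => U V xU x'V.
have [h [Ah hy hU]] := carried_bump xy xU.
have [k [Ak ky kV]] := carried_bump x'y x'V.
apply: contrapT => UV0.
have hk0 z : h z = 0 \/ k z = 0.
  have [Uz|/hU] := pselect (U z); last by left.
  by right; apply: kV => Vz; apply: UV0; exists z.
by case: (phi_disjoint dual Ah Ak hk0 y); rewrite ?hy ?ky => /eqP;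
  rewrite oner_eq0.
Qed.

(** Take a bump h at mu y supported inside U.  Where phi h is nonzero, which
    holds near y, the carrier cannot be a point near which h vanishes. *)
Lemma carrier_continuous (mu : Y -> X) :
  (forall y, carries_zero_germs A phi (mu y) y) -> continuous mu.
Proof.
move=> muP y U yU; rewrite /= !nbhs_simpl.
have [K [cK xK KU]] := compact_closed_nbhs (dual_cptX dual) (dual_hdfX dual) yU.
have [h [Ah hy hK]] := carried_bump (muP y) xK.
have h0 : phi (cst 0) y < phi h y by rewrite hy (phi_cst0 dual).
have := near_lt_fun (sub_continuous dualV (phi_sub dual (sub_cst0 dual)))
                    (sub_continuous dualV (phi_sub dual Ah)) h0.
apply: filterS => z; rewrite (phi_cst0 dual) => hz.
apply: contrapT => nU; suff hz0 : phi h z = 0 by rewrite hz0 ltxx in hz.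
apply: muP => //; apply: filterS (hK) _; apply: open_nbhs_nbhs; split.
  exact: closed_openC.
by move=> /KU /interior_subset.
Qed.

(** If h is a bump supported where f <= g, then f /\ h <= g everywhere, and
    phi (f /\ h) agrees with phi f at y. *)
Lemma phi_local_monotone x y f g : carries_zero_germs A phi x y ->
  A f -> A g -> (\forall z \near x, f z <= g z) -> phi f y <= phi g y.
Proof.
move=> xy Af Ag fg; have [h [Ah hy h0]] := carried_bump xy fg.
have [_ phimin _] := dual_isoA dual; have [_ Amin _] := dual_latA dual.
have /andP[_ f1] := sub_itv dualV y (phi_sub dual Af).
rewrite -(min_l f1) -hy -[leLHS]/((phi f \min phi h) y) -phimin //.
apply: (phi_monotone dual) => // [|z /=]; first exact: Amin.
have [fgz|/h0 ->] := pselect (f z <= g z); first by rewrite ge_min fgz.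
by have /andP[g0 _] := sub_itv dual z Ag; rewrite ge_min g0 orbT.
Qed.

Lemma carried_lt_le x y f g : carries_zero_germs A phi x y ->
  A f -> A g -> phi f y < phi g y -> f x <= g x.
Proof.
move=> xy Af Ag; rewrite ltNge [f x <= _]leNgt => /negP phi_gf.
apply/negP => gf; apply: phi_gf; apply: (phi_local_monotone xy Ag Af).
have := near_lt_fun (sub_continuous dual Ag) (sub_continuous dual Af) gf.
by apply: filterS => z /ltW.
Qed.

End Germs.

(** * Generic points *)

(** At such points, no jump of phi covers the interval ]a, b[: functions of A
    with images at most a and at least b at y must differ at mu y. *)
Definition separating_set (R : realType) (X Y : topologicalType)
    (A : set (X -> R)) (phi : (X -> R) -> (Y -> R)) (mu : Y -> X) (a b : R) :
    set Y :=
  [set y | exists f g, [/\ A f, A g, f (mu y) < g (mu y),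
                            a < phi f y & phi g y < b]].

(** The enumeration of the sets above over rational 0 <= p < q <= 1; every other
    index gives the whole space, which does not affect the intersection. *)
Definition rational_separating_set (R : realType) (X Y : topologicalType)
    (A : set (X -> R)) (phi : (X -> R) -> (Y -> R)) (mu : Y -> X) (n : nat) :
    set Y :=
  if unpickle n is Some (p, q) then
    if (0 <= ratr p :> R) && (ratr p < ratr q :> R) && (ratr q <= 1 :> R)
    then separating_set A phi mu (ratr p) (ratr q) else setT
  else setT.

Lemma dense_evaluation_between (R : realType) (X : topologicalType)
    (A : set (X -> R)) (x : X) (a b : R) :
  dense_evaluation A -> 0 <= a -> a < b -> b <= 1 ->
  exists2 f, A f & a < f x < b.
Proof.
move=> dA a0 ab b1.
have mid : (a + b) / 2 \in `]a, b[ by exact: mid_in_itvoo.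
have : closure [set f x | f in A] ((a + b) / 2).
  apply: dA => /=; move: mid; rewrite !in_itv /= => /andP[am mb].
  by rewrite (le_trans a0 (ltW am)) (le_trans (ltW mb) b1).
move=> /(_ `]a, b[%classic) [|_ [[f Af <-]]]; last by rewrite /= in_itv; exists f.
by apply: open_nbhs_nbhs; split; [exact: itv_open|].
Qed.

Section Separation.
Variables (R : realType) (X Y : topologicalType).
Variables (A : set (X -> R)) (B : set (Y -> R)).
Variables (phi : (X -> R) -> (Y -> R)) (psi : (Y -> R) -> (X -> R)).
Variables (mu : Y -> X) (nu : X -> Y).
Hypothesis dual : lattice_duality A B phi psi.
Hypothesis muP : forall y, carries_zero_germs A phi (mu y) y.
Hypothesis mu_cts : continuous mu.
Hypothesis nu_cts : continuous nu.
Hypothesis muK : cancel mu nu.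
Hypothesis nuK : cancel nu mu.
Let dualV := dual_sym dual.

Lemma separating_set_open a b : open (separating_set A phi mu a b).
Proof.
rewrite openE => y [f [g [Af Ag fg af gb]]].
have fc := sub_continuous dualV (phi_sub dual Af).
have gc := sub_continuous dualV (phi_sub dual Ag).
have near_fg : \forall z \near y, f (mu z) < g (mu z).
  exact: (mu_cts (near_lt_fun (sub_continuous dual Af)
                              (sub_continuous dual Ag) fg)).
have near_a := near_lt_fun (@cst_continuous _ _ a) fc af.
have near_b := near_lt_fun gc (@cst_continuous _ _ b) gb.
by apply: filterS3 near_fg near_a near_b => z ? ? ?; exists f, g.
Qed.

(** Near a given y, functions h, k of B take values in ]a, b[ with h < k.  Were
    no point of the given open set separated by psi h and psi k, then
    psi k <= psi h would hold near mu y, and k y <= h y would follow. *)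
Lemma separating_set_dense a b : dense_evaluation B ->
  0 <= a -> a < b -> b <= 1 -> dense (separating_set A phi mu a b).
Proof.
move=> dB a0 ab b1 O [y Oy] oO.
have [h Bh /andP[ah hb]] := dense_evaluation_between y dB a0 ab b1.
have h0 : 0 <= h y by exact: le_trans a0 (ltW ah).
have [k Bk /andP[hk kb]] := dense_evaluation_between y dB h0 hb b1.
have hc := sub_continuous dualV Bh; have kc := sub_continuous dualV Bk.
have near_a := near_lt_fun (@cst_continuous _ _ a) hc ah.
have near_b := near_lt_fun kc (@cst_continuous _ _ b) kb.
have near_O : \forall z \near y, O z by exact: open_nbhs_nbhs.
apply: contrapT => OS0.
suff : k y <= h y by rewrite leNgt hk.
have Ah := phi_sub dualV Bh; have Ak := phi_sub dualV Bk.
rewrite -(dual_psiK dual Bk) -(dual_psiK dual Bh).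
apply: (phi_local_monotone dual (@muP y) Ak Ah).
have near_y : \forall z \near nu (mu y), [/\ O z, a < h z & k z < b].
  by rewrite muK; apply: filterS3 near_O near_a near_b => z.
have near_x : \forall x \near mu y, [/\ O (nu x), a < h (nu x) & k (nu x) < b].
  exact: (nu_cts near_y).
apply: filterS near_x => x [Ox ax xb].
rewrite leNgt; apply/negP => hkx; apply: OS0; exists (nu x); split => //.
by exists (psi h), (psi k); rewrite nuK !(dual_psiK dual).
Qed.

Lemma rational_separating_set_open n :
  open (rational_separating_set A phi mu n).
Proof.
rewrite /rational_separating_set; case: unpickle => [[p q]|]; last exact: openT.
by case: ifP => _; [exact: separating_set_open|exact: openT].
Qed.

Lemma rational_separating_set_dense n : dense_evaluation B ->
  dense (rational_separating_set A phi mu n).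
Proof.
move=> dB; rewrite /rational_separating_set.
have dT : dense [set: Y] by move=> O O0 _; rewrite setIT.
case: unpickle => [[p q]|//]; case: ifP => // /andP[/andP[p0 pq] q1].
exact: separating_set_dense.
Qed.

(** Insert rationals phi f y < p < q < phi g y; a pair separating at (p, q)
    makes the weak inequality of [carried_lt_le] strict. *)
Lemma phi_lt_reflects y f g :
  (forall n, rational_separating_set A phi mu n y) ->
  A f -> A g -> phi f y < phi g y -> f (mu y) < g (mu y).
Proof.
move=> sep Af Ag fg.
have /andP[f0 _] := sub_itv dualV y (phi_sub dual Af).
have /andP[_ g1] := sub_itv dualV y (phi_sub dual Ag).
have [p] := rat_in_itvoo fg; rewrite in_itv /= => /andP[fp pg].
have [q] := rat_in_itvoo pg; rewrite in_itv /= => /andP[pq qg].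
have := sep (pickle (p, q)); rewrite /rational_separating_set pickleK.
rewrite (le_trans f0 (ltW fp)) pq (le_trans (ltW qg) g1) /=.
move=> [h [k [Ah Ak hk ph kq]]].
apply: (le_lt_trans (carried_lt_le dual (@muP y) Af Ah (lt_trans fp ph))).
apply: lt_le_trans hk (carried_lt_le dual (@muP y) Ak Ag (lt_trans kq qg)).
Qed.

End Separation.

Theorem theorem2p1 (R : realType) (X Y : topologicalType)
    (compactX : compact [set: X]) (hausdorffX : hausdorff_space X)
    (compactY : compact [set: Y]) (hausdorffY : hausdorff_space Y)
    (A : set (X -> R)) (B : set (Y -> R))
    (latA : sublattice_CI A) (latB : sublattice_CI B)
    (uryA : urysohn_property A) (uryB : urysohn_property B)
    (phi : (X -> R) -> (Y -> R)) (isophi : lattice_isomorphism A B phi) :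
  exists mu : Y -> X,
    [/\ (forall y : Y, unique (corresponds A B phi y) (mu y)),
        homeomorphism mu &
        (mul_closed A -> mul_closed B ->
         dense_evaluation A -> dense_evaluation B ->
         exists (Y0 : set Y) (m : Y -> R -> R),
           [/\ Gdelta Y0,
               dense Y0,
               (forall y, Y0 y -> increasing_bijection_I (m y)) &
               (forall f y, A f -> Y0 y -> phi f y = m y (f (mu y)))])].
Proof.
have dual := duality_of_iso compactX hausdorffX compactY hausdorffY
  latA latB uryA uryB isophi.
set psi := pinv A phi in dual; have dualV := dual_sym dual.
have [mu muV] := choice (exists_carried dual).
have [nu nuV] := choice (exists_carried dualV).
have muP y : carries_zero_germs A phi (mu y) y.
  exact: (carries_zero_germs_sym dual (muV y)).
have nuP x : carries_zero_germs B psi (nu x) x.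
  exact: (carries_zero_germs_sym dualV (nuV x)).
have muK : cancel mu nu by move=> y; exact: (carried_unique dualV (nuP _) (muV y)).
have nuK : cancel nu mu by move=> x; exact: (carried_unique dual (muP _) (nuV x)).
have mu_cts := carrier_continuous dual muP.
have nu_cts := carrier_continuous dualV nuP.
exists mu; split.
- move=> y; split; first exact: muV.
  by move=> x /(carries_zero_germs_sym dual); exact: (carried_unique dual (muP y)).
- by split => //; exists nu.
move=> _ _ dA dB.
(* The condition on psi at mu y makes phi f y < phi g y follow from
   f (mu y) < g (mu y); the one on phi gives the converse. *)
pose S y n := rational_separating_set A phi mu n y /\
              rational_separating_set B psi nu n (mu y).
have oF n : open [set y | S y n].
  apply: openI; first exact: (rational_separating_set_open dual mu_cts).
  apply: open_comp => [y _|]; first exact: mu_cts.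
  exact: (rational_separating_set_open dualV nu_cts).
(* The second dense set lives in X: it is met inside the pullback along nu of
   an open subset of Y. *)
have dF n : dense [set y | S y n].
  move=> O O0 oO.
  have oS := rational_separating_set_open dual mu_cts n.
  have dS := rational_separating_set_dense dual muP nu_cts muK nuK n dB.
  have [y OSy] := dS O O0 oO.
  have oOS := open_comp (fun x _ => nu_cts x) (openI oO oS).
  have dS' := rational_separating_set_dense dualV nuP mu_cts nuK muK n dA.
  have [|x [[Ox Sx] Sx']] := dS' _ _ oOS; first by exists (mu y); rewrite /= muK.
  by exists (nu x); split => //; split => //; rewrite nuK.
pose Y0 := \bigcap_n [set y | S y n].
have extend y : exists m : R -> R, Y0 y ->
    increasing_bijection_I m /\ forall f, A f -> m (f (mu y)) = phi f y.
  have [Sy|nSy] := pselect (Y0 y); last by exists id => /nSy.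
  pose T s t := exists f, [/\ A f, s = f (mu y) & t = phi f y].
  have TP f : A f -> T (f (mu y)) (phi f y) by exists f.
  have [||||||m [mI mT]] := @monotone_graph_extension R T.
  - move=> _ _ [f [Af -> ->]].
    by rewrite !in_itv /= (sub_itv dual) // (sub_itv dualV) //; exact: phi_sub dual _ Af.
  - by rewrite -{2}(phi_cst0 dual y); exact: (TP (cst 0) (sub_cst0 dual)).
  - by rewrite -{2}(phi_cst1 dual y); exact: (TP (cst 1) (sub_cst1 dual)).
  - move=> _ _ _ _ [f [Af -> ->]] [g [Ag -> ->]].
    apply/idP/idP; last first.
      by apply: (phi_lt_reflects dual muP) => // n; have [] := Sy n I.
    have Bf := phi_sub dual Af; have Bg := phi_sub dual Ag.
    have := @phi_lt_reflects _ _ _ _ _ _ _ _ dualV nuP (mu y) _ _ _ Bf Bg.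
    rewrite muK !(dual_phiK dual) //; apply.
    by move=> n; have [] := Sy n I.
  - move=> a b a0 ab b1.
    have [f Af fab] := dense_evaluation_between (mu y) dA a0 ab b1.
    by exists (f (mu y)), (phi f y); split => //; exact: TP.
  - move=> a b a0 ab b1.
    have [g Bg gab] := dense_evaluation_between y dB a0 ab b1.
    exists (psi g (mu y)), (g y); split => //.
    by rewrite -{2}(dual_psiK dual Bg); apply: TP; exact: (phi_sub dualV Bg).
  by exists m => _; split => // f Af; apply: mT; exact: TP.
have [m mP] := choice extend.
exists Y0, m; split.
- by exists (fun n => [set y | S y n]).
- exact: compact_baire.
- by move=> y /mP [].
- by move=> f y Af /mP [_ ->].
Qed.
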